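(* Let $m, n \ge 2$ be integers. Let $A = (a_{ij})$ and $B = (b_{ij})$ be the $m \times n$ real checkered pattern matrices defined, for $1 \le i \le m$ and $1 \le j \le n$, by $$a_{ij} = \begin{cases} 1 & \text{if } i+j \text{ is even},\\ 0 & \text{if } i+j \text{ is odd},\end{cases} \qquad b_{ij} = \begin{cases} 1 & \text{if } i+j \text{ is even},\\ -1 & \text{if } i+j \text{ is odd}.\end{cases}$$ Then the rank of $A$ is $2$ and the rank of $B$ is $1$.
   Context: Ranks are taken over the real numbers. The matrices are the checkered patterns $$A = \begin{pmatrix} 1 & 0 & 1 & 0 & \cdots \\ 0 & 1 & 0 & 1 & \cdots \\ 1 & 0 & 1 & 0 & \cdots \\ 0 & 1 & 0 & 1 & \cdots \\ \vdots & \vdots & \vdots & \vdots & \ddots \end{pmatrix}, \qquad B = \begin{pmatrix} 1 & -1 & 1 & -1 & \cdots \\ -1 & 1 & -1 & 1 & \cdots \\ 1 & -1 & 1 & -1 & \cdots \\ -1 & 1 & -1 & 1 & \cdots \\ \vdots & \vdots & \vdots & \vdots & \ddots \end{pmatrix},$$ each of size $m \times n$. *)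

(* Defs.v *)
From mathcomp Require Import all_boot all_order all_algebra.
From mathcomp Require Import reals.

Set Implicit Arguments.
Unset Strict Implicit.
Unset Printing Implicit Defensive.

Import Order.TTheory GRing.Theory Num.Theory.
Local Open Scope ring_scope.

(* Ordinals start at 0, so the 1-based indices of the entry at (i, j) are
   i.+1 and j.+1. *)

Definition checkerA (R : realType) (m n : nat) : 'M[R]_(m, n) :=
  \matrix_(i < m, j < n) (if ~~ odd (i.+1 + j.+1) then 1 else 0).

Definition checkerB (R : realType) (m n : nat) : 'M[R]_(m, n) :=
  \matrix_(i < m, j < n) (if ~~ odd (i.+1 + j.+1) then 1 else -1).

(* Main.v *)
Require Import Defs.
From mathcomp Require Import all_boot all_order all_algebra.
From mathcomp Require Import reals.

Set Implicit Arguments.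
Unset Strict Implicit.
Unset Printing Implicit Defensive.

Import Order.TTheory GRing.Theory Num.Theory.
Local Open Scope ring_scope.

(** Both matrices depend on their indices only through parities, and they are
    products [X_m *m X_n^T] of a matrix [X] with itself at the two sizes: for
    [checkerA], [X] is the [m x 2] incidence matrix of indices and parity
    classes ([parity_mx]); for [checkerB], it is the column of alternating
    signs ([sign_col]).  As soon as both parities occur, [parity_mx] has full
    column rank 2, since its first two rows form the identity; [sign_col] has
    rank 1 because it is nonzero.  A product [X_m *m X_n^T] in which both
    factors have full rank has the common inner dimension as its rank
    ([mxrank_mul_tr_full]). *)

Lemma mxrank_mul_tr_full (F : fieldType) (m n k : nat)
    (X : 'M[F]_(m, k)) (Y : 'M[F]_(n, k)) :
  \rank X = k -> \rank Y = k -> \rank (X *m Y^T) = k.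
Proof.
by move=> rkX rkY; rewrite mxrankMfree // /row_free mxrank_tr rkY.
Qed.

Definition parity_mx (F : fieldType) (n : nat) : 'M[F]_(n, 2) :=
  \matrix_(i < n, k < 2) (odd i == odd k)%:R.

Definition sign_col (F : fieldType) (n : nat) : 'cV[F]_n :=
  \col_(i < n) (-1) ^+ i.

Lemma mxrank_parity (F : fieldType) (n : nat) :
  (2 <= n)%N -> \rank (parity_mx F n) = 2%N.
Proof.
move=> n_ge2; apply/eqP; rewrite eqn_leq rank_leq_col /=.
have top_id : rowsub (widen_ord n_ge2) (parity_mx F n) = 1%:M.
  by apply/matrixP=> -[[|[|[]]] ?] // -[[|[|[]]] ?] //; rewrite !mxE.
by rewrite -{1}(mxrank1 F 2) -top_id mxrankS ?rowsub_sub.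
Qed.

Lemma mxrank_sign_col (F : fieldType) (n : nat) :
  (0 < n)%N -> \rank (sign_col F n) = 1%N.
Proof.
move=> n_gt0; rewrite -mxrank_tr rank_rV.
suff -> : (sign_col F n)^T != 0 by [].
apply/eqP=> /matrixP/(_ 0 (Ordinal n_gt0)); rewrite !mxE expr0.
by apply/eqP/oner_neq0.
Qed.

Lemma checkerA_factor (R : realType) (m n : nat) :
  checkerA R m n = parity_mx R m *m (parity_mx R n)^T.
Proof.
apply/matrixP=> i j; rewrite !mxE big_ord_recr big_ord1 !mxE /= oddD /=.
by case: (odd i); case: (odd j); rewrite /= ?(mulr0, mulr1, mul0r, addr0, add0r).
Qed.

Lemma checkerB_factor (R : realType) (m n : nat) :
  checkerB R m n = sign_col R m *m (sign_col R n)^T.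
Proof.
apply/matrixP=> i j; rewrite !mxE big_ord1 !mxE -exprD -signr_odd !oddD /=.
by case: (odd i); case: (odd j).
Qed.

Theorem proposition1 (R : realType) (m n : nat)
    (hm : (2 <= m)%N) (hn : (2 <= n)%N) :
  \rank (checkerA R m n) = 2%N /\ \rank (checkerB R m n) = 1%N.
Proof.
rewrite checkerA_factor checkerB_factor.
by split; apply: mxrank_mul_tr_full;
  rewrite ?mxrank_parity ?mxrank_sign_col // ltnW.
Qed.
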